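(* For a fixed $(x,y)\in\mathcal{X}$, the problem $\sup_{\mathbb{P}\in\mathcal{F}(\hat{\mathbb{P}}^N,\epsilon)}\mathbb{E}_{\mathbb{P}}[Q(x,W)]$ is equivalent to (has the same optimal value as) $$\inf_{\rho\ge 0}\Big\{\epsilon\rho+\Big[\frac1N\sum_{n=1}^N\sup_{W\in\mathcal{S}}\big\{Q(x,W)-\rho\,\|W-\hat W^n\|\big\}\Big]\Big\},$$ where $\rho$ is a scalar variable.
   Context: Let $I$ (customers), $J$ (candidate locations), $M$ (mobile facilities) be finite nonempty index sets and $T=\{1,\dots,|T|\}$ a finite set of time periods. Data: distances $d_{i,j}\ge 0$, travel times $t_{j,j'}\in\mathbb{Z}_{\ge 0}$, assignment cost factor $\beta\ge 0$, capacity $C\ge 0$, unmet-demand penalty $\gamma\ge 0$. The first-stage feasible region $\mathcal{X}$ is the set of all $(x,y)$ with $x_{j,m}^t\in\{0,1\}$, $y_m\in\{0,1\}$ for all $j\in J,m\in M,t\in T$, such that $x_{j,m}^t+x_{j',m}^{t'}\le y_m$ for all $t\in T$, $m\in M$, $j,j'\in J$ with $j\ne j'$, and $t'\in\{t,\dots,\min\{t+t_{j,j'},|T|\}\}$. For $(x,y)\in\mathcal{X}$ and a demand realization $W=(W_{i,t})_{i\in I,t\in T}\ge 0$, the recourse function is $$Q(x,W)=\min_{z,u}\ \sum_{j\in J}\sum_{i\in I}\sum_{m\in M}\sum_{t\in T}\beta d_{i,j}z_{i,j,m}^t+\gamma\sum_{t\in T}\sum_{i\in I}u_{i,t}$$ subject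 to $\sum_{j\in J}\sum_{m\in M}z_{i,j,m}^t+u_{i,t}=W_{i,t}$ for all $i\in I,t\in T$; $\sum_{i\in I}z_{i,j,m}^t\le C x_{j,m}^t$ for all $j\in J,m\in M,t\in T$; $u_{i,t}\ge 0$, $z_{i,j,m}^t\ge 0$ for all $i,j,m,t$. The support is $\mathcal{S}=\{W\ge 0:\ \underline{W}_{i,t}\le W_{i,t}\le\overline{W}_{i,t}\ \forall i\in I,t\in T\}$, with given bounds $0\le\underline{W}_{i,t}\le\overline{W}_{i,t}<\infty$; it is nonempty, convex and compact. Let $\mathcal{P}(\mathcal{S})$ be the set of all probability distributions supported on $\mathcal{S}$. Let $\|\cdot\|$ be the $\ell_1$-norm on $\mathbb{R}^{I\times T}$. For $\mathbb{F}_1,\mathbb{F}_2\in\mathcal{P}(\mathcal{S})$ the 1-Wasserstein distance is $$\mathrm{dist}(\mathbb{F}_1,\mathbb{F}_2)=\inf_{\Pi}\int\|W_1-W_2\|\,\Pi(\mathrm{d}W_1,\mathrm{d}W_2),$$ the infimum being over all joint distributions $\Pi$ of $(W_1,W_2)$ supported on $\mathcal{S}\times\mathcal{S}$ with marginals $\mathbb{F}_1$ and $\mathbb{F}_2$. Given $N\ge 1$ sample points $\hat W^1,\dots,\hat W^N\in\mathcal{S}$ and a radius $\epsilon>0$, the empirical distribution is $\hat{\mathbb{P}}^N=\frac1N\sum_{n=1}^N\delta_{\hat W^n}$ and the ambiguity set is $\mathcal{F}(\hat{\mathbb{P}}^N,\epsilon)=\{\mathbb{P}\in\mathcal{P}(\mathcal{S}):\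 \mathrm{dist}(\mathbb{P},\hat{\mathbb{P}}^N)\le\epsilon\}$. *)

(* Defs.v *)
From HB Require Import structures.
From mathcomp Require Import all_boot all_order all_algebra.
From mathcomp Require Import all_classical all_reals all_analysis.

Set Implicit Arguments.
Unset Strict Implicit.
Unset Printing Implicit Defensive.

Import Order.TTheory GRing.Theory Num.Theory.
Import numFieldNormedType.Exports.

Local Open Scope classical_set_scope.
Local Open Scope ring_scope.

(* Time periods 1, ..., K are encoded as 'I_K, i.e. shifted by one. *)

(* R^(I x T) with the sigma-algebra generated by the coordinate maps; as I x T
   is finite, this is the Borel sigma-algebra. *)
Definition coordinate_sets (R : realType) (I : finType) (K : nat) :
    set (set (I * 'I_K -> R)) :=
  \bigcup_(p : I * 'I_K)
    preimage_set_system [set: I * 'I_K -> R] (fun W => W p) measurable.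

Arguments coordinate_sets : clear implicits.

Notation demand R I K := (g_sigma_algebraType (coordinate_sets R I K)).

Section first_stage.
Context (J M : finType) (K : nat).

(* The range of t' is {t, ..., min(t + tau j j', K)}; the bound by the number of
   periods K is built into t' : 'I_K. *)
Definition first_stage_region (tau : J -> J -> nat) :
    set ((J -> M -> 'I_K -> bool) * (M -> bool)) :=
  [set xy : (J -> M -> 'I_K -> bool) * (M -> bool) |
   forall (t : 'I_K) (m : M) (j j' : J) (t' : 'I_K), j != j' ->
     (t <= t' <= t + tau j j')%N ->
     (xy.1 j m t + xy.1 j' m t' <= xy.2 m)%N].

End first_stage.

Section recourse.
Context (R : realType) (I J M : finType) (K : nat).
Implicit Types (W : demand R I K) (x : J -> M -> 'I_K -> bool)
  (z : I -> J -> M -> 'I_K -> R) (u : I -> 'I_K -> R).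

Definition recourse_feasible (C : R) x W z u : Prop :=
  [/\ forall i t, \sum_(j : J) \sum_(m : M) z i j m t + u i t = W (i, t),
      forall j m t, \sum_(i : I) z i j m t <= C * (x j m t)%:R,
      forall i t, 0 <= u i t
    & forall i j m t, 0 <= z i j m t].

Definition recourse_cost (d : I -> J -> R) (beta gamma : R) z u : R :=
  \sum_(j : J) \sum_(i : I) \sum_(m : M) \sum_(t < K) beta * d i j * z i j m t
  + gamma * \sum_(t < K) \sum_(i : I) u i t.

(* The optimal value of the recourse linear program. For W >= 0 the program is
   feasible and, the data being nonnegative, bounded below and attains its
   minimum. For the other W, which lie outside every support set below, the
   program is infeasible and [inf set0 = 0]. *)
Definition recourse (d : I -> J -> R) (beta C gamma : R) x W : R :=
  inf [set c | exists z u,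
         recourse_feasible C x W z u /\ c = recourse_cost d beta gamma z u].

End recourse.

Section ambiguity.
Context (R : realType) (I : finType) (K : nat).
Local Notation V := (demand R I K).

Definition norm1 (w : I * 'I_K -> R) : R := \sum_p `|w p|.

Definition support_set (Wlo Whi : I * 'I_K -> R) : set V :=
  [set W | forall p, 0 <= W p /\ Wlo p <= W p <= Whi p].

Definition distributions_on (S : set V) : set (probability V R) :=
  [set P | P S = 1%E].

Definition couplings (S : set V) (F1 F2 : {measure set V -> \bar R}) :
    set (probability (V * V)%type R) :=
  [set Pi | [/\ Pi (S `*` S) = 1%E,
      forall A, measurable A -> Pi (fst @^-1` A) = F1 A
    & forall A, measurable A -> Pi (snd @^-1` A) = F2 A]].

Definition wasserstein (S : set V) (F1 F2 : {measure set V -> \bar R}) :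
    \bar R :=
  ereal_inf [set (\int[Pi]_w (norm1 (w.1 \- w.2))%:E)%E
            | Pi in couplings S F1 F2].

Section empirical.
Context (N : nat) (What : 'I_N -> V).

Definition empirical (A : set V) : \bar R :=
  (N%:R^-1%:E * \sum_(n < N) \d_(What n) A)%E.

Let m (n : nat) : {measure set V -> \bar R} :=
  if insub n is Some i then \d_(What i) else mzero.

Let empiricalE : empirical = mscale (N%:R^-1)%:nng (msum m N).
Proof.
apply/funext => A; rewrite /empirical /mscale /msum /=; congr (_ * _)%E.
by apply: eq_bigr => i _; rewrite /m valK.
Qed.

Let empirical0 : empirical set0 = 0%E.
Proof. by rewrite empiricalE measure0. Qed.

Let empirical_ge0 A : (0 <= empirical A)%E.
Proof. by rewrite empiricalE measure_ge0. Qed.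

Let empirical_sigma_additive : semi_sigma_additive empirical.
Proof. by rewrite empiricalE; exact: measure_semi_sigma_additive. Qed.

HB.instance Definition _ := isMeasure.Build _ _ _ empirical
  empirical0 empirical_ge0 empirical_sigma_additive.

Lemma empirical_supported (S : set V) :
  (0 < N)%N -> (forall n, S (What n)) -> empirical S = 1%E.
Proof.
move=> N0 SW; rewrite /empirical (eq_bigr (fun=> 1%E)); last first.
  by move=> n _; rewrite diracE mem_set.
by rewrite sumEFin sumr_const card_ord -EFinM mulVf// pnatr_eq0 -lt0n.
Qed.

End empirical.

Definition ambiguity_set (S : set V) (Phat : {measure set V -> \bar R})
    (eps : R) : set (probability V R) :=
  [set P | distributions_on S P /\ (wasserstein S P Phat <= eps%:E)%E].

End ambiguity.

(* Main.v *)
Require Import Defs.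
From HB Require Import structures.
From mathcomp Require Import all_boot all_order all_algebra.
From mathcomp Require Import all_classical all_reals all_analysis.
From mathcomp Require Import measurable_realfun ring lra.

(** Weak duality. Let [phi rho w] be the supremum over [W] in [S] of
    [Q W - rho * norm1 (W \- w)]. For a coupling of [P] and the empirical
    distribution, [Q W1 <= rho * norm1 (W1 \- W2) + phi rho W2] holds almost
    surely; integrating, and taking couplings of cost close to the Wasserstein
    distance, bounds the expectation of [Q] by [eps * rho] plus the sample mean
    of [phi rho] ([expectation_le_dual]).

    Strong duality. It suffices to consider the distributions obtained by moving
    every sample point to some place of [S], and the mixtures of two such
    distributions ([ambiguity_mixture]). The pairs (transport cost, expected
    value) of the unmixed ones form a planar set containing a point of cost [0],
    which is below [eps]. If [v] bounds the expectations over the ambiguity set,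
    mixtures of two points of the planar set within the budget [eps] do not
    exceed [v], so some line through [(eps, v)] of slope [rho >= 0] lies above
    the whole planar set ([supporting_slope]). Optimizing the target of each
    sample point separately turns this into the statement that the dual
    objective at [rho] is at most [v] ([exists_dual_slope]).

    This argument needs from [Q] only that it is nonnegative, bounded on [S] and
    measurable ([wasserstein_duality]); neither the convexity nor the
    compactness of [S] matters. The recourse function is [gamma]-Lipschitz for
    the l1-norm on nonnegative demands ([recourse_lipschitz]), and a Lipschitz
    function is measurable for the sigma-algebra of the coordinates
    ([lipschitz_measurable]). *)

Set Implicit Arguments.
Unset Strict Implicit.
Unset Printing Implicit Defensive.

Import Order.TTheory GRing.Theory Num.Theory.
Import numFieldNormedType.Exports.

Local Open Scope classical_set_scope.
Local Open Scope ring_scope.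

(** * Demands: the l1-norm and measurability *)

Section coordinates.
Context (R : realType) (I : finType) (K : nat).
Local Notation V := (demand R I K).
Implicit Types (a b c W : V).

Lemma norm1_ge0 a : 0 <= norm1 a.
Proof. by apply: sumr_ge0. Qed.

Lemma norm1B a b : norm1 (a \- b) = norm1 (b \- a).
Proof. by apply: eq_bigr => p _; rewrite distrC. Qed.

Lemma norm1_triangle b a c : norm1 (a \- c) <= norm1 (a \- b) + norm1 (b \- c).
Proof.
rewrite /norm1 -big_split; apply: ler_sum => p _ /=.
by rewrite (le_trans _ (ler_normD _ _))// addrA subrK.
Qed.

Lemma norm1_diag a : norm1 (a \- a) = 0.
Proof. by apply: big1 => p _; rewrite /= subrr normr0. Qed.

Lemma measurable_coordinate (p : I * 'I_K) :
  measurable_fun [set: V] (fun W : V => W p).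
Proof.
move=> _ A mA; apply: sub_sigma_algebra.
by exists p => //; exists A.
Qed.

Lemma measurable_norm1 d (T : measurableType d) (f g : T -> V) :
  measurable_fun setT f -> measurable_fun setT g ->
  measurable_fun setT (fun t => norm1 (f t \- g t)).
Proof.
move=> mf mg; apply: measurable_sum => p.
apply: measurableT_comp => //.
by apply: measurable_funB; apply: measurableT_comp (measurable_coordinate p) _.
Qed.

Lemma rational_approx W (e : R) : 0 < e ->
  exists q : {ffun I * 'I_K -> rat}, norm1 (W \- (fun p => ratr (q p))) < e.
Proof.
move=> e0.
have n0 : 0 < #|{: I * 'I_K}|%:R + 1 :> R by rewrite ltr_wpDl.
pose h : R := e / (#|{: I * 'I_K}|%:R + 1).
have h0 : 0 < h by rewrite divr_gt0.
have /(_ _)/cid-/all_sig[q qP] : forall p, exists r : rat, ratr r \in `]W p - h, W p + h[.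
  by move=> p; apply: rat_in_itvoo; rewrite ltrBlDr -addrA ltrDl addr_gt0.
exists (finfun q); apply: (@le_lt_trans _ _ (\sum_(p : I * 'I_K) h)).
  apply: ler_sum => p _; rewrite /= ffunE ltW// ltr_distlC.
  by have := qP p; rewrite in_itv.
rewrite sumr_const -mulr_natr /h mulrAC ltr_pdivrMr// mulrDr mulr1 ltrDl //.
Qed.

(** The sublevel sets of a Lipschitz function are countable unions of
    measurable sets indexed by the rational points. *)
Lemma lipschitz_measurable (f : V -> R) (L : R) : 0 <= L ->
  (forall a b, f a - f b <= L * norm1 (a \- b)) -> measurable_fun [set: V] f.
Proof.
move=> L0 fL.
apply: (measurability _ (RGenInftyO.measurableE R)) => //.
move=> _ [_ [c ->] <-]; rewrite setTI.
pose Q (q : {ffun I * 'I_K -> rat}) : V := fun p => ratr (q p).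
pose F q : set V := [set W | f (Q q) + L * norm1 (W \- Q q) < c].
rewrite [X in measurable X](_ : _ = \bigcup_q F q).
  apply: countable_bigcupT_measurable => // q.
  pose g (W : V) := f (Q q) + L * norm1 (W \- Q q).
  have mg : measurable_fun setT g.
    apply: measurable_funD => //; apply: measurable_funM => //.
    exact: measurable_norm1.
  have := mg measurableT `]-oo, c[%classic (measurable_itv _).
  by rewrite setTI preimage_itvNyo.
apply/seteqP; split => W /=; rewrite in_itv/=.
  (* [f] at a rational point [q] exceeds [f W] by at most [L] times the distance,
     so that this distance has to be counted twice. *)
  move=> fWc; pose e := (c - f W) / (L + L + 1).
  have L1 : 0 < L + L + 1 by rewrite ltr_wpDl ?addr_ge0.
  have e0 : 0 < e by rewrite divr_gt0// subr_gt0.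
  have [q qe] := rational_approx W e0; exists q => //.
  have := fL (Q q) W; rewrite norm1B /F/= => h.
  have : (L + L + 1) * norm1 (W \- Q q) < c - f W.
    by rewrite mulrC -ltr_pdivlMr.
  have := norm1_ge0 (W \- Q q); lra.
move=> [q _]; rewrite /F/=; have := fL W (Q q); lra.
Qed.

Lemma measurable_support_set (lo hi : I * 'I_K -> R) :
  measurable (support_set lo hi : set V).
Proof.
rewrite [X in measurable X](_ : _ =
  \bigcap_(p : I * 'I_K) [set W : V | Num.max 0 (lo p) <= W p <= hi p]).
  apply: fin_bigcap_measurable => // p _.
  have := measurable_coordinate p measurableT (measurable_itv `[Num.max 0 (lo p), hi p]).
  rewrite setTI; congr measurable; apply/seteqP; split=> W /=; by rewrite in_itv.
apply/seteqP; split=> W /=.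
  by move=> SW p _ /=; rewrite ge_max; have [-> /andP[-> ->]] := SW p.
by move=> SW p; have := SW p Logic.I; rewrite /= ge_max => /andP[/andP[-> ->] ->].
Qed.

Lemma measurable_orthant : measurable [set W : V | forall p, 0 <= W p].
Proof.
rewrite [X in measurable X](_ : _ =
  \bigcap_(p : I * 'I_K) [set W : V | 0 <= W p]).
  apply: fin_bigcap_measurable => // p _.
  have := measurable_coordinate p measurableT (measurable_itv `[0, +oo[).
  by rewrite setTI preimage_itvcy.
apply/seteqP; split=> W /= W0 p; first by move=> _; exact: W0.
exact: (W0 p Logic.I).
Qed.

End coordinates.

(** * The recourse function *)

Section recourse_properties.
Context (R : realType) (I J M : finType) (K : nat).
Variables (d : I -> J -> R) (d_ge0 : forall i j, 0 <= d i j).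
Variables (beta C gamma : R).
Hypotheses (beta_ge0 : 0 <= beta) (C_ge0 : 0 <= C) (gamma_ge0 : 0 <= gamma).
Variable (x : J -> M -> 'I_K -> bool).
Local Notation V := (demand R I K).
Local Notation Q := (recourse d beta C gamma x).
Local Notation feasible := (recourse_feasible C x).
Local Notation cost := (recourse_cost d beta gamma).
Implicit Types W : V.

Lemma recourse_cost_ge0 W z u : feasible W z u -> 0 <= cost z u.
Proof.
move=> [_ _ u0 z0]; apply: addr_ge0.
  by do 4 (apply: sumr_ge0 => ? _); rewrite !mulr_ge0.
by apply: mulr_ge0 => //; do 2 (apply: sumr_ge0 => ? _).
Qed.

Lemma recourse_has_lbound W :
  has_lbound [set c | exists z u, feasible W z u /\ c = cost z u].
Proof.
by exists 0 => _ [z [u [f ->]]]; exact: recourse_cost_ge0 f.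
Qed.

Lemma recourse_le W z u : feasible W z u -> Q W <= cost z u.
Proof.
by move=> f; apply: ge_inf; [exact: recourse_has_lbound | exists z, u].
Qed.

(** Serving no demand at all is feasible. *)
Lemma recourse_feasible_unmet W : (forall p, 0 <= W p) ->
  feasible W (fun _ _ _ _ => 0) (fun i t => W (i, t)).
Proof.
move=> W0; split => // [i t|j m t].
  by rewrite big1 ?add0r// => j _; rewrite big1.
by rewrite big1// mulr_ge0.
Qed.

Lemma le_recourse W c : (forall p, 0 <= W p) ->
  (forall z u, feasible W z u -> c <= cost z u) -> c <= Q W.
Proof.
move=> W0 h; apply: lb_le_inf.
  by eexists; do 2 eexists; split; first exact: recourse_feasible_unmet.
by move=> _ [z [u [f ->]]]; exact: h.
Qed.

Lemma recourse_infeasible W : ~ (forall p, 0 <= W p) -> Q W = 0.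
Proof.
move=> nW; rewrite /recourse [X in inf X](_ : _ = set0) ?inf0//.
rewrite -subset0 => _ [z [u [[e _ u0 z0] ->]]]; apply: nW => -[i t].
by rewrite -e addr_ge0//; apply: sumr_ge0 => j _; apply: sumr_ge0.
Qed.

Lemma recourse_bounded (hi : I * 'I_K -> R) :
  exists B, forall W, (forall p, 0 <= W p <= hi p) -> Q W <= B.
Proof.
exists (gamma * \sum_(t < K) \sum_(i : I) hi (i, t)) => W h.
have W0 p : 0 <= W p by have /andP[] := h p.
apply: le_trans (recourse_le (recourse_feasible_unmet W0)) _.
rewrite /recourse_cost big1 ?add0r; last first.
  by move=> j _; do 3 (apply: big1 => ? _); rewrite mulr0.
apply: ler_wpM2l => //; apply: ler_sum => t _; apply: ler_sum => i _.
by have /andP[] := h (i, t).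
Qed.

Lemma recourse_ge0 W : 0 <= Q W.
Proof.
have [W0|/recourse_infeasible->//] := pselect (forall p, 0 <= W p).
by apply: le_recourse => // z u; exact: recourse_cost_ge0.
Qed.

(** A feasible plan for [W] becomes feasible for [W'] when all flows out of
    [(i, t)] are scaled down by the ratio [W' (i, t) / W (i, t)] wherever demand
    decreases, and the additional demand is left unmet wherever it increases.
    Only the latter costs more, at the rate [gamma]. *)
Lemma recourse_lipschitz W W' :
  (forall p, 0 <= W p) -> (forall p, 0 <= W' p) ->
  Q W' - Q W <= gamma * norm1 (W' \- W).
Proof.
move=> W0 W'0; suff : Q W' - gamma * norm1 (W' \- W) <= Q W by lra.
apply: le_recourse => // z u [zuW zC u0 z0].
pose r p := if W' p < W p then W' p / W p else 1.
have r01 p : 0 <= r p <= 1.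
  rewrite /r; case: ifPn => [lt|_]; last by rewrite ler01 lexx.
  have W_gt0 := le_lt_trans (W'0 p) lt.
  by rewrite divr_ge0//= ler_pdivrMr// mul1r ltW.
pose z' i j m t := r (i, t) * z i j m t.
pose u' i t := r (i, t) * u i t + Num.max 0 (W' (i, t) - W (i, t)).
have z'z i j m t : z' i j m t <= z i j m t.
  by rewrite ler_piMl//; have /andP[] := r01 (i, t).
have f' : feasible W' z' u'.
  split=> [i t|j m t|i t|i j m t].
  - rewrite /z' /u' addrA.
    under eq_bigr do rewrite -mulr_sumr.
    rewrite -mulr_sumr -mulrDr zuW /r; case: ltP => [lt|ge].
      have W_gt0 := le_lt_trans (W'0 _) lt.
      by rewrite divfK ?gt_eqF// max_l ?addr0// subr_le0 ltW.
    by rewrite max_r ?subr_ge0// mul1r addrC subrK.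
  - exact: le_trans (ler_sum _ _) (zC j m t).
  - rewrite addr_ge0 ?le_max ?lexx// mulr_ge0//; by have /andP[] := r01 (i, t).
  - rewrite mulr_ge0//; by have /andP[] := r01 (i, t).
apply: (@le_trans _ _ (cost z' u' - gamma * norm1 (W' \- W))).
  by rewrite lerD2r; exact: recourse_le.
rewrite lerBlDr -addrA; apply: lerD.
  do 4 (apply: ler_sum => ? _); by rewrite ler_wpM2l// mulr_ge0.
rewrite -mulrDr; apply: ler_wpM2l => //.
rewrite /norm1 (eq_bigr (fun p => `|(W' \- W) (p.1, p.2)|)); last by case.
rewrite -(pair_bigA _ (fun i t => `|(W' \- W) (i, t)|))/=.
rewrite [X in _ + X]exchange_big -big_split/=.
apply: ler_sum => t _; rewrite -big_split; apply: ler_sum => i _ /=.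
apply: lerD; first by rewrite ler_piMl//; have /andP[] := r01 (i, t).
by rewrite ge_max normr_ge0 ler_norm.
Qed.

(** The Lipschitz bound only holds on nonnegative demands; precomposing with the
    positive part extends it to all of them, and elsewhere [Q] vanishes. *)
Lemma measurable_recourse : measurable_fun [set: V] Q.
Proof.
pose pos W : V := fun p => Num.max 0 (W p).
have pos_ge0 W p : 0 <= pos W p by rewrite le_max lexx.
have mpos : measurable_fun [set: V] (fun W => Q (pos W)).
  apply: lipschitz_measurable gamma_ge0 _ => a b.
  apply: le_trans (recourse_lipschitz (pos_ge0 b) (pos_ge0 a)) _.
  apply: ler_wpM2l => //; apply: ler_sum => p _ /=.
  by rewrite /pos; case: (leP 0 (a p)); case: (leP 0 (b p)) => ? ?;
    rewrite ler_norml; have := ler_norm (a p - b p);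
    have := ler_norm (- (a p - b p)); rewrite normrN; lra.
have -> : Q = (fun W => Q (pos W) * \1_[set W : V | forall p, 0 <= W p] W).
  apply/funext => W; have [W0|nW] := pselect (forall p, 0 <= W p).
    rewrite indicE mem_set// mulr1; congr (Q _).
    by apply/funext => p; rewrite /pos max_r.
  by rewrite recourse_infeasible// indicE memNset// mulr0.
apply: measurable_funM => //; apply: measurable_indic.
exact: measurable_orthant.
Qed.

End recourse_properties.

(** * Planar Lagrangian duality *)

(** One-dimensional Lagrangian duality. [A] is a set of attainable pairs
    (cost, value) containing a pair of cost below [eps]; if no mixture of two
    pairs within the budget [eps] exceeds the value [v], then a line of slope
    [rho >= 0] through [(eps, v)] lies above [A]. *)
Lemma supporting_slope (R : realType) (A : set (R * R)) (eps v : R) a0 :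
  A a0 -> a0.1 < eps ->
  (forall a b l, A a -> A b -> 0 <= l <= 1 ->
    l * a.1 + (1 - l) * b.1 <= eps -> l * a.2 + (1 - l) * b.2 <= v) ->
  exists2 rho, 0 <= rho & forall a, A a -> a.2 - rho * a.1 <= v - rho * eps.
Proof.
move=> Aa0 a0eps Amix.
have Av a : A a -> a.1 <= eps -> a.2 <= v.
  move=> Aa ae; have := Amix a a 1 Aa Aa; rewrite subrr !mul0r !mul1r !addr0 ler01 lexx.
  by apply.
(* The slope from [(eps, v)] to a point over the budget is at most the slope
   to [(eps, v)] from a point under the budget. *)
have slope a b : A a -> A b -> a.1 < eps -> eps < b.1 ->
    (b.2 - v) / (b.1 - eps) <= (v - a.2) / (eps - a.1).
  move=> Aa Ab ae eb.
  have ha : 0 < eps - a.1 by lra.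
  have hb : 0 < b.1 - eps by lra.
  have hD : 0 < b.1 - a.1 by lra.
  rewrite ler_pdivrMr// mulrAC ler_pdivlMr//.
  (* The mixture of weight [l] on [b] spends exactly the budget [eps]. *)
  pose l := (eps - a.1) / (b.1 - a.1).
  have lD : l * (b.1 - a.1) = eps - a.1 by rewrite divfK// gt_eqF.
  have l0 : 0 <= l by rewrite divr_ge0// ltW.
  have l1 : l <= 1 by rewrite ler_pdivrMr//; lra.
  have : l * b.2 + (1 - l) * a.2 <= v.
    by apply: Amix => //; [rewrite l0|lra].
  move=> /(ler_wpM2l (ltW hD)).
  have -> : (b.1 - a.1) * (l * b.2 + (1 - l) * a.2) =
    (l * (b.1 - a.1)) * b.2 + (b.1 - a.1 - l * (b.1 - a.1)) * a.2 by ring.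
  rewrite lD; nra.
pose E := [set s | s = 0 \/ exists b, [/\ A b, eps < b.1 & s = (b.2 - v) / (b.1 - eps)]].
have ubE a : A a -> a.1 < eps -> ubound E ((v - a.2) / (eps - a.1)).
  move=> Aa ae _ [->|[b [Ab be ->]]]; last exact: slope.
  by rewrite divr_ge0// subr_ge0; [apply: Av => //|]; exact: ltW.
have hE : has_ubound E by eexists; exact: ubE Aa0 a0eps.
exists (sup E); first by apply: ub_le_sup => //; left.
move=> a Aa; have [ae|ea|ae] := ltgtP a.1 eps.
- have : sup E <= (v - a.2) / (eps - a.1).
    by apply: ge_sup; [exists 0; left|exact: ubE].
  rewrite ler_pdivlMr ?subr_gt0//; lra.
- have : (a.2 - v) / (a.1 - eps) <= sup E.
    by apply: ub_le_sup => //; right; exists a.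
  rewrite ler_pdivrMr ?subr_gt0//; lra.
- by rewrite ae lerD2r; apply: Av => //; rewrite ae.
Qed.

(** * Finitely supported distributions *)

Lemma mean_cst (R : realType) (N : nat) (r : R) :
  (0 < N)%N -> N%:R^-1 * \sum_(n < N) r = r.
Proof.
by move=> N_gt0; rewrite sumr_const card_ord -[r *+ N]mulr_natl mulKf// pnatr_eq0 -lt0n.
Qed.

Section probability_of_measure.
Context d (T : measurableType d) (R : realType).
Variables (mu : {measure set T -> \bar R}) (mu1 : mu setT = 1%E).

(** A measure of total mass one, as a probability; the argument only records
    the proof on which the probability structure depends. *)
Definition total_mass1 (_ : mu setT = 1%E) := (mu : set T -> \bar R).

HB.instance Definition _ := Measure.on (total_mass1 mu1).
HB.instance Definition _ :=
  Measure_isProbability.Build _ _ _ (total_mass1 mu1) mu1.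

Lemma probability_of_measure : exists P : probability T R, forall A, P A = mu A.
Proof. by exists [the probability _ _ of total_mass1 mu1]. Qed.

End probability_of_measure.

Section point_masses.
Context d (T : measurableType d) (R : realType) (N : nat).

(** The measure with mass [c] at each of the points [a i], counted with
    multiplicity. *)
Definition point_masses (c : {nonneg R}) (a : 'I_N -> T) :
    {measure set T -> \bar R} :=
  [the measure _ _ of mscale c (msum (fun n =>
     if insub n is Some i then [the measure T R of \d_(a i)]
     else [the measure T R of mzero]) N)].

Lemma point_massesE c a A :
  point_masses c a A = (c%:num%:E * \sum_(i < N) \d_(a i) A)%E.
Proof.
rewrite /point_masses /= /mscale /msum; congr (_ * _)%E.
by apply: eq_bigr => i _; rewrite valK.
Qed.

Lemma integral_point_masses c a (f : T -> R) :
  measurable_fun setT f -> (forall t, 0 <= f t) ->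
  (\int[point_masses c a]_t (f t)%:E)%E = (c%:num * \sum_(i < N) f (a i))%:E.
Proof.
move=> mf f0; have mfE : measurable_fun setT (EFin \o f) by exact/measurable_EFinP.
rewrite /point_masses/= ge0_integral_mscale//; last by move=> t _; rewrite lee_fin.
rewrite ge0_integral_measure_sum//; last by move=> t _; rewrite lee_fin.
rewrite EFinM -sumEFin; congr (_ * _)%E; apply: eq_bigr => i _.
by rewrite valK integral_dirac// diracT mul1e.
Qed.

Local Notation mean F := (N%:R^-1 * \sum_(n < N) F n).

(** The distribution giving weight [l / N] to each [a n] and [(1 - l) / N] to
    each [a' n]. *)
Lemma mixture_probability (l : R) (a a' : 'I_N -> T) :
  (0 < N)%N -> 0 <= l <= 1 ->
  exists P : probability T R,
    (forall A, P A = (l * mean (fun n => \1_A (a n)) +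
                      (1 - l) * mean (fun n => \1_A (a' n)))%:E) /\
    (forall g : T -> R, measurable_fun setT g -> (forall t, 0 <= g t) ->
      (\int[P]_t (g t)%:E)%E = (l * mean (fun n => g (a n)) +
                               (1 - l) * mean (fun n => g (a' n)))%:E).
Proof.
move=> N_gt0 /andP[l0 l1].
have l1' : 0 <= 1 - l by rewrite subr_ge0.
have Ni0 : 0 <= N%:R^-1 :> R by [].
pose c := NngNum (mulr_ge0 l0 Ni0).
pose c' := NngNum (mulr_ge0 l1' Ni0).
pose mu : {measure set T -> \bar R} :=
  [the measure _ _ of measure_add (point_masses c a) (point_masses c' a')].
have muE A : mu A = (l * mean (fun n => \1_A (a n)) +
    (1 - l) * mean (fun n => \1_A (a' n)))%:E.
  by rewrite [LHS]measure_addE !point_massesE !sumEFin -!EFinM -EFinD !mulrA.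
have mean_setT b : mean (fun n => \1_setT (b n : T)) = 1 :> R.
  under eq_bigr do rewrite indicE in_setT.
  exact: mean_cst.
have [|P PE] := @probability_of_measure _ _ _ mu.
  by rewrite muE !mean_setT !mulr1 addrC subrK.
exists P; split=> [A|g mg g0]; first by rewrite PE.
rewrite (eq_measure_integral mu); last by move=> A _ _; exact: PE.
rewrite /mu ge0_integral_measure_add//; last 2 first.
- by move=> t _; rewrite lee_fin.
- exact/measurable_EFinP.
by rewrite !integral_point_masses// -EFinD !mulrA.
Qed.

End point_masses.

(** * Wasserstein duality *)

Section marginal.
Context d1 d2 (T1 : measurableType d1) (T2 : measurableType d2) (R : realType).

(** Only the values of [nu] on measurable sets are related to [mu], so [nu] need
    not be literally the pushforward of [mu]. *)
Lemma integral_marginal (mu : {measure set T1 -> \bar R})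
    (nu : {measure set T2 -> \bar R}) (g : T1 -> T2) (f : T2 -> R) :
  measurable_fun setT g -> (forall A, measurable A -> mu (g @^-1` A) = nu A) ->
  measurable_fun setT f -> (forall t, 0 <= f t) ->
  (\int[nu]_t (f t)%:E = \int[mu]_t (f (g t))%:E)%E.
Proof.
move=> mg mu_nu mf f0.
rewrite -(@eq_measure_integral _ _ _ setT nu (pushforward mu g)); last first.
  by move=> A mA _; exact: mu_nu.
rewrite ge0_integral_pushforward//.
- exact/measurable_EFinP.
- by move=> t _; rewrite lee_fin.
Qed.

End marginal.

Section wasserstein_duality.
Context (R : realType) (I : finType) (K : nat).
Local Notation V := (demand R I K).
Variables (S : set V) (mS : measurable S).
Context (N : nat) (N_gt0 : (0 < N)%N).
Variables (What : 'I_N -> V) (What_in : forall n, S (What n)).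
Variables (f : V -> R) (B : R).
Hypotheses (mf : measurable_fun [set: V] f) (f_ge0 : forall W, 0 <= f W).
Hypothesis f_le : forall W, S W -> f W <= B.

Local Notation mean F := (N%:R^-1 * \sum_(n < N) F n).

(** The largest value of [f] net of the cost [rho] per unit of distance for
    moving from [w]: the inner supremum of the dual, as a real number. *)
Definition penalized_sup (rho : R) (w : V) : R :=
  sup [set f W - rho * norm1 (W \- w) | W in S].

Let S0 : S !=set0. Proof. by exists (What (Ordinal N_gt0)). Qed.

Section penalized.
Variables (rho : R) (rho_ge0 : 0 <= rho).
Local Notation phi := (penalized_sup rho).

Lemma penalized_has_ubound w :
  has_ubound [set f W - rho * norm1 (W \- w) | W in S].
Proof.
exists B => _ [W SW <-]; have := f_le SW.
have : 0 <= rho * norm1 (W \- w) by rewrite mulr_ge0 ?norm1_ge0.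
lra.
Qed.

Lemma penalized_nonempty w :
  [set f W - rho * norm1 (W \- w) | W in S] !=set0.
Proof. by case: S0 => W SW; eexists; exists W. Qed.

Lemma penalized_supP W w : S W -> f W <= rho * norm1 (W \- w) + phi w.
Proof.
move=> SW; rewrite addrC -lerBlDr; apply: ub_le_sup.
  exact: penalized_has_ubound.
by exists W.
Qed.

Lemma penalized_sup_ge0 w : S w -> 0 <= phi w.
Proof.
move=> Sw; have := penalized_supP w Sw; rewrite norm1_diag mulr0 add0r.
exact: le_trans.
Qed.

Lemma ereal_sup_penalized w :
  ereal_sup [set (f W - rho * norm1 (W \- w))%:E | W in S] = (phi w)%:E.
Proof.
rewrite -(ereal_sup_EFin (penalized_has_ubound w) (penalized_nonempty w)).
by rewrite -image_comp.
Qed.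

Lemma penalized_sup_lipschitz w w' : phi w - phi w' <= rho * norm1 (w \- w').
Proof.
suff : phi w <= phi w' + rho * norm1 (w \- w') by lra.
apply: ge_sup; first exact: penalized_nonempty.
move=> _ [W SW <-]; have := penalized_supP w' SW.
have := ler_wpM2l rho_ge0 (norm1_triangle w W w'); lra.
Qed.

Lemma measurable_penalized_sup : measurable_fun [set: V] phi.
Proof. exact: lipschitz_measurable rho_ge0 penalized_sup_lipschitz. Qed.

Lemma empirical_point_masses A :
  empirical What A = point_masses (N%:R^-1)%:nng What A.
Proof. by rewrite point_massesE. Qed.

(** On [S `*` S], [f] at the first point is at most [rho] times the distance
    between the points plus [penalized_sup rho] at the second point. As that
    supremum may be negative outside [S], its positive part is integrated. *)
Lemma expectation_le_coupling (P : probability V R) Pi :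
  couplings S P (empirical What) Pi ->
  ('E_P[f] <= rho%:E * \int[Pi]_w (norm1 (w.1 \- w.2))%:E
              + (mean (fun n => phi (What n)))%:E)%E.
Proof.
move=> [PiS Pi1 Pi2].
pose psi w := Num.max 0 (phi w).
have psi_ge0 w : 0 <= psi w by rewrite le_max lexx.
have mpsi : measurable_fun setT psi.
  by apply: measurable_maxr => //; exact: measurable_penalized_sup.
have mnorm : measurable_fun setT (fun w : V * V => norm1 (w.1 \- w.2)).
  by apply: measurable_norm1; [exact: measurable_fst|exact: measurable_snd].
have -> : mean (fun n => phi (What n)) = mean (fun n => psi (What n)).
  congr (_ * _); apply: eq_bigr => n _.
  by rewrite /psi max_r// penalized_sup_ge0.
have -> : (mean (fun n => psi (What n)))%:E = (\int[Pi]_w (psi w.2)%:E)%E.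
  rewrite -(integral_point_masses (N%:R^-1)%:nng What mpsi psi_ge0).
  apply: integral_marginal => // A mA; rewrite -empirical_point_masses.
  exact: Pi2.
rewrite unlock (integral_marginal (mu := Pi) (g := fst))//.
rewrite -ge0_integralZl//; last 2 first.
- exact/measurable_EFinP.
- by move=> w _; rewrite lee_fin norm1_ge0.
rewrite -ge0_integralD//; last 4 first.
- by move=> w _; rewrite -EFinM lee_fin mulr_ge0// norm1_ge0.
- by apply/measurable_EFinP; exact: measurable_funM.
- by move=> w _; rewrite lee_fin.
- by apply/measurable_EFinP; exact: measurableT_comp mpsi measurable_snd.
apply: ae_ge0_le_integral => //.
- by move=> w _; rewrite lee_fin.
- by apply/measurable_EFinP; exact: measurableT_comp mf measurable_fst.
- by move=> w _; rewrite -EFinM -EFinD lee_fin addr_ge0// mulr_ge0// norm1_ge0.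
- apply/measurable_EFinP; apply: measurable_funD; first exact: measurable_funM.
  exact: measurableT_comp mpsi measurable_snd.
have mSS : measurable (S `*` S : set (V * V)).
  exact: measurableX.
exists (~` (S `*` S)); split; first exact: measurableC.
  by apply: (etrans (probability_setC Pi mSS)); rewrite PiS subee.
move=> w /=; apply: contra_not => -[Sw1 Sw2] _.
rewrite -EFinM -EFinD lee_fin.
have : phi w.2 <= psi w.2 by rewrite le_max lexx orbT.
have := penalized_supP w.2 Sw1; lra.
Qed.

Lemma expectation_le_dual (P : probability V R) (eps : R) :
  ambiguity_set S (empirical What) eps P ->
  ('E_P[f] <= (eps * rho + mean (fun n => phi (What n)))%:E)%E.
Proof.
move=> [_ weps]; apply/lee_addgt0Pr => e e0.
(* Dividing by [rho + 1] instead of [rho] also covers [rho = 0]. *)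
have rho1 : 0 < rho + 1 by rewrite ltr_wpDl.
have : (wasserstein S P (empirical What) < (eps + e / (rho + 1))%:E)%E.
  by rewrite (le_lt_trans weps)// lte_fin ltrDl divr_gt0.
move=> /ereal_inf_lt[_ [Pi cPi <-] cost].
apply: le_trans (expectation_le_coupling cPi) _.
apply: (@le_trans _ _ (rho%:E * (eps + e / (rho + 1))%:E +
    (mean (fun n => phi (What n)))%:E)%E).
  by rewrite leeD2r// lee_wpmul2l ?lee_fin// ltW.
rewrite -EFinM -!EFinD lee_fin.
have : rho * (e / (rho + 1)) <= e.
  by rewrite mulrCA ger_pMr// ler_pdivrMr// mul1r lerDl.
lra.
Qed.

End penalized.

(** Moving the sample points to [w] with weight [l] and to [w'] with weight
    [1 - l] gives a distribution in the ambiguity set whenever the mean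
    transport cost is within the radius. *)
Lemma ambiguity_mixture (w w' : 'I_N -> V) (l eps : R) :
  (forall n, S (w n)) -> (forall n, S (w' n)) -> 0 <= l <= 1 ->
  l * mean (fun n => norm1 (w n \- What n)) +
    (1 - l) * mean (fun n => norm1 (w' n \- What n)) <= eps ->
  exists2 P, ambiguity_set S (empirical What) eps P &
    'E_P[f]%E = (l * mean (fun n => f (w n)) + (1 - l) * mean (fun n => f (w' n)))%:E.
Proof.
move=> Sw Sw' l01 cost.
have [P [PE intP]] := mixture_probability w w' N_gt0 l01.
have [Pi [PiE intPi]] := mixture_probability
  (fun n => (w n, What n)) (fun n => (w' n, What n)) N_gt0 l01.
have one d (T : measurableType d) (a a' : 'I_N -> T) (A : set T) :
    (forall n, A (a n)) -> (forall n, A (a' n)) ->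
    l * mean (fun n => \1_A (a n)) + (1 - l) * mean (fun n => \1_A (a' n)) = 1.
  move=> Aa Aa'.
  rewrite (eq_bigr (fun=> 1)) => [|n _]; last by rewrite indicE mem_set.
  rewrite [X in _ + _ * (_ * X)](eq_bigr (fun=> 1)) => [|n _]; last first.
    by rewrite indicE mem_set.
  by rewrite mean_cst// !mulr1 addrC subrK.
exists P; last by rewrite unlock intP.
split; first by rewrite /distributions_on /= PE one.
apply: le_trans (_ : (_ <= (l * mean (fun n => norm1 (w n \- What n)) +
    (1 - l) * mean (fun n => norm1 (w' n \- What n)))%:E)%E) _; last by rewrite lee_fin.
apply: ereal_inf_lbound; exists Pi; last first.
  rewrite intPi//; last by move=> t; exact: norm1_ge0.
  by apply: measurable_norm1; [exact: measurable_fst|exact: measurable_snd].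
split => [|A mA|A mA].
- by rewrite PiE one// => n; [exact: (conj (Sw n) (What_in n))|
    exact: (conj (Sw' n) (What_in n))].
- by rewrite PiE; exact: (esym (PE A)).
rewrite PiE/= /empirical sumEFin -EFinM; congr EFin.
by rewrite -mulrDl addrC subrK mul1r.
Qed.

(** Any upper bound [v] on the expectations is at least some value of the dual
    objective: choosing a target in [S] for each sample point gives a pair (mean
    transport cost, mean value), and a line of slope [rho] through [(eps, v)]
    lies above all these pairs. *)
Lemma exists_dual_slope (eps v : R) : 0 < eps ->
  (forall P, ambiguity_set S (empirical What) eps P -> ('E_P[f] <= v%:E)%E) ->
  exists2 rho, 0 <= rho &
    eps * rho + mean (fun n => penalized_sup rho (What n)) <= v.
Proof.
move=> eps0 fv.
pose cost (w : 'I_N -> V) := mean (fun n => norm1 (w n \- What n)).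
pose value (w : 'I_N -> V) := mean (fun n => f (w n)).
pose A := [set (cost w, value w) | w in [set w | forall n, S (w n)]].
have AWhat : A (cost What, value What) by exists What.
have cost0 : cost What = 0.
  by rewrite /cost big1 ?mulr0// => n _; exact: norm1_diag.
have [||rho rho0 slope] := supporting_slope (eps := eps) (v := v) AWhat.
- by rewrite /= cost0.
- move=> _ _ l [w Sw <-] [w' Sw' <-] l01 /= ce.
  have [P Pa EP] := ambiguity_mixture Sw Sw' l01 ce.
  by rewrite -lee_fin -EP; exact: fv.
exists rho => //.
apply/ler_addgt0Pr => e e0.
have /(_ _)/cid2-/all_sig2[w Sw we] n : exists2 W : V, S W &
    penalized_sup rho (What n) - e < f W - rho * norm1 (W \- What n).
  have hs : has_sup [set f W - rho * norm1 (W \- What n) | W in S].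
    by split; [exact: penalized_nonempty|exact: penalized_has_ubound].
  by have [_ [W SW <-] h] := sup_adherent e0 hs; exists W.
have /= := slope (cost w, value w) (imageP _ Sw).
suff : mean (fun n => penalized_sup rho (What n)) <= value w - rho * cost w + e by lra.
rewrite -[X in _ + X](mean_cst e N_gt0).
rewrite /value /cost mulrCA -mulrBr -mulrDr [rho * _]mulr_sumr -sumrB -big_split/=.
apply: ler_wpM2l; first by rewrite invr_ge0.
by apply: ler_sum => n _; have := we n; lra.
Qed.

(** The duality holds for any nonnegative measurable function bounded on the
    measurable support [S]. *)
Theorem wasserstein_duality (eps : R) : 0 < eps ->
  ereal_sup [set ('E_P[f])%E | P in ambiguity_set S (empirical What) eps] =
  ereal_inf
    [set ((eps * rho)%:E +
          N%:R^-1%:E *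
          \sum_(n < N)
            ereal_sup [set (f W - rho * norm1 (W \- What n))%:E | W in S])%E
    | rho in [set rho : R | (0 <= rho)%R]].
Proof.
move=> eps0.
have dualE rho : 0 <= rho -> ((eps * rho)%:E + N%:R^-1%:E * \sum_(n < N)
      ereal_sup [set (f W - rho * norm1 (W \- What n))%:E | W in S])%E =
    (eps * rho + mean (fun n => penalized_sup rho (What n)))%:E.
  move=> rho0; under eq_bigr do rewrite ereal_sup_penalized//.
  by rewrite sumEFin -EFinM -EFinD.
apply/eqP; rewrite eq_le; apply/andP; split.
  apply: ge_ereal_sup => _ [P aP <-].
  apply: le_ereal_inf_tmp => _ [rho rho0 <-].
  by rewrite dualE//; exact: expectation_le_dual.
case E : (ereal_sup _) => [v| |]; last 2 first.
- exact: leey.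
- (* Leaving the sample points in place shows that the ambiguity set is not
     empty. *)
  have [||P aP _] := @ambiguity_mixture What What 1 eps What_in What_in.
  + by rewrite ler01 lexx.
  + rewrite big1 => [|n _]; last exact: norm1_diag.
    by rewrite !mulr0 addr0 ltW.
  have := ereal_sup_ubound (imageP (fun P : probability V R => 'E_P[f]%E) aP).
  by rewrite E leeNy_eq => /eqP h; have := expectation_ge0 P f_ge0; rewrite h.
have [|rho rho0 h] := @exists_dual_slope eps v eps0.
  move=> P aP; rewrite -E.
  exact: ereal_sup_ubound (imageP (fun P : probability V R => 'E_P[f]%E) aP).
apply: le_trans (_ : (_ <= _)%E) _; first by apply: ereal_inf_lbound; exists rho.
by rewrite dualE// lee_fin.
Qed.

End wasserstein_duality.

Theorem proposition3 (R : realType) (I J M : finType) (K : nat)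
    (I_gt0 : (0 < #|I|)%N) (J_gt0 : (0 < #|J|)%N) (M_gt0 : (0 < #|M|)%N)
    (d : I -> J -> R) (d_ge0 : forall i j, 0 <= d i j)
    (tau : J -> J -> nat)
    (beta C gamma : R)
    (beta_ge0 : 0 <= beta) (C_ge0 : 0 <= C) (gamma_ge0 : 0 <= gamma)
    (Wlo Whi : I * 'I_K -> R)
    (Wbounds : forall p, 0 <= Wlo p <= Whi p)
    (N : nat) (N_gt0 : (0 < N)%N)
    (What : 'I_N -> demand R I K)
    (What_in : forall n, support_set Wlo Whi (What n))
    (eps : R) (eps_gt0 : 0 < eps)
    (x : J -> M -> 'I_K -> bool) (y : M -> bool)
    (xy_in : first_stage_region tau (x, y)) :
  let S := support_set Wlo Whi in
  let Q := recourse d beta C gamma x in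
  ereal_sup [set ('E_P[Q])%E | P in ambiguity_set S (empirical What) eps] =
  ereal_inf
    [set ((eps * rho)%:E +
          N%:R^-1%:E *
          \sum_(n < N)
            ereal_sup [set (Q W - rho * norm1 (W \- What n))%:E | W in S])%E
    | rho in [set rho : R | (0 <= rho)%R]].
Proof.
move=> S Q.
have [B QB] := recourse_bounded d_ge0 beta_ge0 C_ge0 gamma_ge0 x Whi.
apply: (@wasserstein_duality _ _ _ _ _ _ N_gt0 _ _ _ B) => //.
- exact: measurable_support_set.
- exact: measurable_recourse.
- by move=> W; exact: recourse_ge0.
- by move=> W SW; apply: QB => p; have [-> /andP[_ ->]] := SW p.
Qed.
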